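(* There exists a strictly ergodic Toeplitz subshift $Y\subseteq\{0,1\}^{\mathbb Z}$ such that $\eta_{2,2}^{-1}(Y)$ is minimal, but not uniquely ergodic.
   Context: $\{0,1\}^{\mathbb Z}$ carries the product topology; $\sigma$ is the left shift, $\sigma(x)_n=x_{n+1}$. A subshift is a closed $\sigma$-invariant subset. A system is minimal if all orbits are dense, uniquely ergodic if it has exactly one invariant Borel probability measure, and strictly ergodic if both. $\eta_{2,2}:\{0,1\}^{\mathbb Z}\to\{0,1\}^{\mathbb Z}$ is given by $\eta_{2,2}(x)_n=x_{n+1}-x_n\bmod2$. A sequence $\xi\in\{0,1\}^{\mathbb Z}$ is a Toeplitz sequence if it is not periodic and for every $n\in\mathbb Z$ there is $p\ge1$ with $\xi_{n+pk}=\xi_n$ for all $k\in\mathbb Z$. A Toeplitz subshift is the subshift $X_\xi=\{x\mid\text{every finite word occurring in }x\text{ occurs in }\xi\}$ of a Toeplitz sequence $\xi$ (equivalently, the orbit closure of $\xi$). *)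

(* Defs.v *)
From HB Require Import structures.
From mathcomp Require Import all_boot all_order all_algebra.
From mathcomp Require Import all_classical all_reals all_analysis.

Set Implicit Arguments.
Unset Strict Implicit.
Unset Printing Implicit Defensive.

Import Order.TTheory GRing.Theory Num.Theory.
Local Open Scope classical_set_scope.
Local Open Scope ring_scope.

(* The alphabet {0,1} is bool (discrete topology). *)
Definition full_shift : Type := prod_topology (fun _ : int => bool).

HB.instance Definition _ := Pointed.on full_shift.
HB.instance Definition _ := Nbhs.on full_shift.
HB.instance Definition _ := Topological.on full_shift.

Definition shift (x : full_shift) : full_shift := fun n => x (n + 1).

(* The iterate of exponent k : int of the homeomorphism shift; see
   shift_iter1 and shift_iterD. *)
Definition shift_iter (k : int) (x : full_shift) : full_shift :=
  fun n => x (n + k).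

Lemma shift_iter1 : shift_iter 1 = shift.
Proof. by []. Qed.

Lemma shift_iter0 : shift_iter 0 = id.
Proof. by apply/funext => x; apply/funext => n; rewrite /shift_iter addr0. Qed.

Lemma shift_iterD (k l : int) :
  shift_iter (k + l) = shift_iter k \o shift_iter l.
Proof.
by apply/funext => x; apply/funext => n; rewrite /shift_iter /= addrA.
Qed.

Definition shift_orbit (x : full_shift) : set full_shift :=
  range (fun k : int => shift_iter k x).

Definition subshift (X : set full_shift) : Prop :=
  closed X /\ shift @` X = X.

(* For a subshift X, every orbit is dense in the subspace X. *)
Definition minimal (X : set full_shift) : Prop :=
  forall x, X x -> X `<=` closure (shift_orbit x).

Definition borel_full_shift := g_sigma_algebraType (@open full_shift).

(* The Borel probability measures on a closed set X are represented by the
   Borel probability measures mu on the whole space such that mu X = 1. *)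
Definition invariant_probability (R : realType) (X : set full_shift)
    (mu : probability borel_full_shift R) : Prop :=
  mu X = 1%E /\
  forall A : set borel_full_shift, measurable A -> mu (shift @^-1` A) = mu A.

(* The values of a measure on non-measurable sets are irrelevant, hence
   uniqueness is up to equality on Borel sets. *)
Definition uniquely_ergodic (R : realType) (X : set full_shift) : Prop :=
  exists2 mu : probability borel_full_shift R, invariant_probability X mu &
    forall nu : probability borel_full_shift R, invariant_probability X nu ->
      forall A : set borel_full_shift, measurable A -> nu A = mu A.

Definition strictly_ergodic (R : realType) (X : set full_shift) : Prop :=
  minimal X /\ uniquely_ergodic R X.

(* Subtraction modulo 2 on bool is exclusive or. *)
Definition eta22 (x : full_shift) : full_shift :=
  fun n => x (n + 1) (+) x n.

Definition periodic (x : full_shift) : Prop :=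
  exists2 p : nat, (0 < p)%N & forall n : int, x (n + p%:Z) = x n.

Definition toeplitz (xi : full_shift) : Prop :=
  ~ periodic xi /\
  forall n : int, exists2 p : nat, (0 < p)%N &
    forall k : int, xi (n + p%:Z * k) = xi n.

Definition occurs_in (w : seq bool) (x : full_shift) : Prop :=
  exists i : int, w = [seq x (i + k%:Z) | k <- iota 0 (size w)].

Definition subshift_of (xi : full_shift) : set full_shift :=
  [set x | forall w, occurs_in w x -> occurs_in w xi].

Definition toeplitz_subshift (Y : set full_shift) : Prop :=
  exists2 xi, toeplitz xi & Y = subshift_of xi.

Lemma coord_continuous (n : int) : continuous (fun x : full_shift => x n).
Proof. exact: (@proj_continuous int (fun=> bool) n). Qed.

Lemma nbhs_coord (x : full_shift) (n : int) :
  \forall y \near x, (y : full_shift) n = x n.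
Proof. exact: (@coord_continuous n x [set b | b = x n]). Qed.

Lemma occurs_in_shift w x : occurs_in w (shift x) <-> occurs_in w x.
Proof.
split=> -[i ->].
  exists (i + 1); rewrite size_map size_iota; apply: eq_map => k.
  by rewrite /shift addrAC.
exists (i - 1); rewrite size_map size_iota; apply: eq_map => k.
by rewrite /shift addrAC subrK.
Qed.

Lemma shiftK : cancel shift (shift_iter (-1)).
Proof.
by move=> x; apply/funext => n; rewrite /shift /shift_iter subrK.
Qed.

Lemma shift_iterK : cancel (shift_iter (-1)) shift.
Proof.
by move=> x; apply/funext => n; rewrite /shift /shift_iter addrK.
Qed.

Lemma subshift_subshift_of xi : subshift (subshift_of xi).
Proof.
split.
  move=> x clx w [i ew].
  have xnear : \forall y \near x, forall k : 'I_(size w),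
      y (i + (k : nat)%:Z) = x (i + (k : nat)%:Z).
    apply: (@filter_forall full_shift 'I_(size w) (fun k y =>
      y (i + (k : nat)%:Z) = x (i + (k : nat)%:Z)) (nbhs x) (nbhs_filter x)).
    by move=> k; exact: nbhs_coord.
  have [y [Xy yx]] := clx _ xnear.
  apply: Xy; exists i; rewrite [LHS]ew; apply/eq_in_map => k.
  by rewrite mem_iota => /= kw; rewrite -(yx (Ordinal kw)).
apply/seteqP; split=> [_ [x Xx <-] w /occurs_in_shift|x Xx]; first exact: Xx.
exists (shift_iter (-1) x); last exact: shift_iterK.
by move=> w wx; apply: Xx; rewrite -(shift_iterK x); apply/occurs_in_shift.
Qed.

Lemma eta22_shift x : eta22 (shift x) = shift (eta22 x).
Proof. by []. Qed.

Lemma eta22_continuous : continuous eta22.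
Proof.
move=> x; apply/cvg_sup => n U [_ [[W oW <-] /= Wx WU]].
change (nbhs x (eta22 @^-1` U)).
near=> y; apply: WU; rewrite /= /eta22.
rewrite (_ : y (n + 1) = x (n + 1)); last by near: y; exact: nbhs_coord.
by rewrite (_ : y n = x n) //; near: y; exact: nbhs_coord.
Unshelve. all: by end_near. Qed.

Lemma subshift_eta22_preimage Y : subshift Y -> subshift (eta22 @^-1` Y).
Proof.
move=> [clY sY]; split.
  by apply: closed_comp clY => x _; exact: eta22_continuous.
apply/seteqP; split=> [_ [x Yx <-]|x Yx] /=.
  by rewrite eta22_shift -sY; exists (eta22 x).
exists (shift_iter (-1) x); last exact: shift_iterK.
have : (shift @` Y) (eta22 x) by rewrite sY.
move=> [y Yy yx] /=; rewrite -[X in Y X]shiftK -eta22_shift shift_iterK.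
by rewrite -yx shiftK.
Qed.

(* Main.v *)
Require Import Defs.
From HB Require Import structures.
From mathcomp Require Import all_boot all_order all_algebra.
From mathcomp Require Import all_classical all_reals all_analysis.
From mathcomp Require Import zify lra.
Import Defs.
Set Implicit Arguments.
Unset Strict Implicit.
Unset Printing Implicit Defensive.
Import Order.TTheory GRing.Theory Num.Theory.
Local Open Scope classical_set_scope.
Local Open Scope ring_scope.

(** A point of eta22 @^-1` Y is determined by its image y and by one symbol,
and its complement has the same image: the preimage is the skew product of Y
by Z/2 over the cocycle y |-> y 0.  The theorem needs a Toeplitz system on
which this cocycle is a coboundary of a measurable function but of no
continuous one.  The measurable coboundary splits the lift of the invariant
measure into two complementary measures; the absence of a continuous one keeps
the lift minimal.

The example comes from words B_n of odd length p_n = scale n.  The word B_(n+1)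
consists of q_n = base n = 2 * radius n + 1 copies of B_n, and the copy next to
the middle one, on its right, is complemented.  As every B_n is the middle part
of B_(n+1), the words converge to a two-sided sequence xi.  In other words, if
m is written in the mixed radix q_0, q_1, ... with digits from - radius k to
radius k, then xi m is the parity of the number of digits equal to 1.

Differences do not see the complementation of a whole block.  Therefore
eta22 xi is a single word of length p_n - 1 repeated over and over, where
consecutive copies are separated by one symbol (a hole) that is only
determined at later levels.  Each position is a hole at finitely many levels
only, so eta22 xi is a Toeplitz sequence (toeplitz_eta_xi).  The holes of
level n have density 1 / p_n, which tends to 0; hence the frequency of any
pattern is the same in all points of the orbit closure, which gives unique
ergodicity (unique_invariant_eta_xi).

Every long enough stretch of a point above the orbit closure contains both B_n
and its complement, because B_(n+1) does and so does the complement of B_(n+1)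
(recurrence).  This gives minimality upstairs (minimal_preimage_eta_xi).

On the other hand complemented blocks are rare: the sum of 1 / q_k is at most
1/4.  Choose a compatible sequence of uniformly distributed residues
J_n modulo p_n, that is, a random point of the odometer, and shift the
p_n-periodic sequence (B_n)^oo by J_n.  Level n changes a given symbol with
probability 1 / q_n, so by the Borel-Cantelli argument the shifted sequences
converge almost surely in every coordinate.  The law of the limit is an
invariant measure on the preimage for which the symbol 1 has probability at
most 1/4 (limit_measure); its image under complementation is another one, with
probability at least 3/4. *)

(** * Balanced mixed-radix digits *)

Definition radius (k : nat) : nat := 2 ^ k.+2.

Definition base (k : nat) : nat := (2 * radius k).+1.

Fixpoint scale (n : nat) : nat := if n is n'.+1 then scale n' * base n' else 1.

(** The integers are cut into intervals of length scale n, the one with index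
a being centred at scale n * a; block n m is the index of the interval
containing m.  Adding the radius before dividing centres the digits. *)
Fixpoint block (n : nat) (m : int) : int :=
  if n is n'.+1 then ((block n' m + (radius n')%:Z) %/ (base n')%:Z)%Z else m.

(** The digit of rank k of m equals 1: the blocks of level k that are
complemented inside their block of level k + 1. *)
Definition flip (k : nat) (m : int) : bool := (block k m %% (base k)%:Z)%Z == 1.

Fixpoint xi_part (n : nat) : full_shift := fun m =>
  if n is n'.+1 then xi_part n' m (+) flip n' m else false.

(** Digits of rank at least `|m| vanish at m, so that this truncation is the
parity over all ranks; see xi_partE. *)
Definition xi : full_shift := fun m => xi_part `|m|%N m.

Lemma radius_gt1 k : (1 < radius k)%N.
Proof. by rewrite /radius -[X in (X < _)%N](expn0 2) ltn_exp2l. Qed.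

Lemma base_neq0 k : (base k)%:Z != 0.
Proof. by rewrite /base; lia. Qed.

Lemma scale_gt0 n : (0 < scale n)%N.
Proof. by elim: n => //= n IH; rewrite muln_gt0 IH. Qed.

(** The partition of level n is invariant under translation by scale n. *)
Lemma blockD n m a : block n (m + (scale n)%:Z * a) = block n m + a.
Proof.
elim: n m a => [|n IH] m a /=; first by rewrite mul1r.
rewrite PoszM -mulrA IH addrAC [_ + _ * a]addrC mulrC divzMDl ?base_neq0 //.
exact: addrC.
Qed.

Lemma block0 n : block n 0 = 0.
Proof.
elim: n => //= n ->; rewrite add0r divz_small //.
by rewrite /base; lia.
Qed.

Lemma block_scale n a : block n ((scale n)%:Z * a) = a.
Proof. by rewrite -[_ * _]add0r blockD block0 add0r. Qed.

Lemma le_block n m m' : m <= m' -> block n m <= block n m'.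
Proof.
by elim: n => //= n IH /IH mm'; rewrite lez_pdiv2r // lerD2r.
Qed.

Lemma block_eq n k m m' : (n <= k)%N -> block n m = block n m' ->
  block k m = block k m'.
Proof.
move=> nk e; elim: k nk => [|k IH].
  by rewrite leqn0 => /eqP n0; rewrite n0 in e.
by rewrite leq_eqVlt => /predU1P[<-//|/IH] /= ->.
Qed.

Lemma block_eq0 n k m : (n <= k)%N -> block n m = 0 -> block k m = 0.
Proof.
by move=> nk m0; rewrite -(block0 k); apply: block_eq nk _; rewrite block0.
Qed.

Lemma flipD k n m a : (k < n)%N -> flip k (m + (scale n)%:Z * a) = flip k m.
Proof.
move=> kn; rewrite /flip.
have [c ->] : exists c : nat, (scale n = scale k * base k * c)%N.
  elim: n kn => // n IH; rewrite ltnS leq_eqVlt => /predU1P[->|/IH[c ec]].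
    by exists 1%N; rewrite muln1.
  by exists (c * base n)%N; rewrite /= ec mulnA.
rewrite !PoszM -!mulrA blockD addrC [_ * (_ * a)]mulrC modzMDl //.
Qed.

Lemma xi_partD n m a : xi_part n (m + (scale n)%:Z * a) = xi_part n m.
Proof.
suff H k : (k <= n)%N -> xi_part k (m + (scale n)%:Z * a) = xi_part k m.
  exact: H.
by elim: k => //= k IH kn; rewrite flipD // IH // ltnW.
Qed.

Lemma flip_eq n k m m' : (n <= k)%N -> block n m = block n m' ->
  flip k m = flip k m'.
Proof. by move=> nk e; rewrite /flip (block_eq nk e). Qed.

Lemma flip0 n k m : (n <= k)%N -> block n m = 0 -> flip k m = false.
Proof. by move=> nk e; rewrite /flip (block_eq0 nk e) mod0z. Qed.

(** The block of level n and index 0 is the interval [- reach n, reach n]. *)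
Fixpoint reach (n : nat) : nat :=
  if n is n'.+1 then (radius n' * scale n' + reach n')%N else 0%N.

Lemma scale_reach n : scale n = (2 * reach n).+1.
Proof. elim: n => //= n ->; rewrite /base; nia. Qed.

Lemma leq_reach n : (n <= reach n)%N.
Proof.
by elim: n => //= n IH; have := radius_gt1 n; have := scale_gt0 n; nia.
Qed.

Lemma block_reach n : block n (reach n)%:Z = 0 /\ block n (- (reach n)%:Z) = 0.
Proof.
elim: n => //= n [IH1 IH2].
have -> : ((radius n * scale n + reach n)%N)%:Z =
    (reach n)%:Z + (scale n)%:Z * (radius n)%:Z by lia.
rewrite opprD -mulrN !blockD IH1 IH2 !add0r addNr div0z; split=> //.
by rewrite divz_small // /base; lia.
Qed.

Lemma block_small n m : (`|m| <= reach n)%N -> block n m = 0.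
Proof.
move=> mn; have [h1 h2] := block_reach n.
apply: le_anti; apply/andP; split.
  by rewrite -[leRHS]h1 le_block //; lia.
by rewrite -[leLHS]h2 le_block //; lia.
Qed.

Lemma xi_partE n m : block n m = 0 -> xi_part n m = xi m.
Proof.
rewrite /xi => n0.
have a0 : block `|m|%N m = 0 by apply: block_small; exact: leq_reach.
suff H k l : block k m = 0 -> (k <= l)%N -> xi_part l m = xi_part k m.
  by case: (leqP n `|m|%N) => [/H->|/ltnW/H->].
move=> k0; elim: l => [|l IH]; first by rewrite leqn0 => /eqP->.
rewrite leq_eqVlt => /predU1P[->//|kl] /=.
by rewrite (@flip0 k l m kl k0) addbF IH.
Qed.

Lemma common_block (m m' : int) : exists n, block n m = 0 /\ block n m' = 0.
Proof.
exists (`|m| + `|m'|)%N.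
split; apply: block_small; apply: leq_trans (leq_reach _).
  exact: leq_addr.
exact: leq_addl.
Qed.

(** Inside one block of level n all later digits are constant, so that they
cancel in a difference: this is why eta22 forgets complementation. *)
Lemma xi_same n m m' : block n m = block n m' ->
  xi m (+) xi m' = xi_part n m (+) xi_part n m'.
Proof.
move=> e; have [N0 [m0 m'0]] := common_block m m'.
set N := (n + N0)%N.
have mN : block N m = 0 by apply: block_eq0 m0; rewrite leq_addl.
have m'N : block N m' = 0 by apply: block_eq0 m'0; rewrite leq_addl.
rewrite -(xi_partE mN) -(xi_partE m'N) /N.
elim: {N mN m'N} N0 {m0 m'0} => [|N IH]; first by rewrite addn0.
rewrite addnS /= (flip_eq _ e) ?leq_addr // -IH.
by rewrite addbACA addbb addbF.
Qed.

Lemma xi_part0 n : xi_part n 0 = false.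
Proof. by elim: n => //= n ->; rewrite (@flip0 0). Qed.

Lemma xi_part_scale n a : xi_part n ((scale n)%:Z * a) = false.
Proof. by rewrite -[_ * _]add0r xi_partD xi_part0. Qed.

(** Each block of level n carries the central one, complemented or not
according to the symbol at its centre. *)
Lemma xi_translate n a v : block n v = 0 ->
  xi ((scale n)%:Z * a + v) = xi ((scale n)%:Z * a) (+) xi v.
Proof.
move=> v0; have e : block n (v + (scale n)%:Z * a) = block n ((scale n)%:Z * a).
  by rewrite blockD block_scale v0 add0r.
have := xi_same e; rewrite xi_partD xi_part_scale addbF (xi_partE v0) addrC.
move=> <-.
by rewrite addbC -addbA addbb addbF.
Qed.

(** The two neighbours of the central block of level n lie in the central block
of level n + 1 because there are at least three subblocks. *)
Lemma block_scale_next n (e v : int) : `|e| <= 1 -> block n v = 0 ->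
  block n.+1 ((scale n)%:Z * e + v) = 0.
Proof.
move=> e1 v0 /=; rewrite [_ * e + v]addrC blockD v0 add0r divz_small //.
by have := radius_gt1 n; rewrite /base; lia.
Qed.

Lemma xi_scale n (e : int) : `|e| <= 1 -> xi ((scale n)%:Z * e) = (e == 1).
Proof.
move=> e1; have := block_scale_next e1 (block0 n); rewrite addr0 => e0.
rewrite -(xi_partE e0) /= xi_part_scale addFb /flip.
rewrite block_scale; have := radius_gt1 n => r1.
have [->|->|->] : [\/ e = -1, e = 0 | e = 1].
- have : (e == -1) || (e == 0) || (e == 1) by lia.
  by case/orP=> [/orP[]|] /eqP->; [constructor 1|constructor 2|constructor 3].
- by rewrite -modzDl modz_small /base; lia.
- by rewrite mod0z.
- by rewrite modz_small //; rewrite /base; lia.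
Qed.

(** * The Toeplitz sequence *)

Definition eta_xi : full_shift := eta22 xi.

Lemma eta_partD n m a :
  eta22 (xi_part n) (m + (scale n)%:Z * a) = eta22 (xi_part n) m.
Proof. by rewrite /eta22 addrAC !xi_partD. Qed.

(** A position m with block n (m + 1) <> block n m is a hole of level n: the
only places where later levels can modify the difference sequence. *)
Lemma eta_xi_eq_part n m : block n (m + 1) = block n m ->
  eta_xi m = eta22 (xi_part n) m.
Proof. exact: xi_same. Qed.

(** The two holes at the ends of the central block of level n carry different
symbols, since the right neighbour of this block is complemented and the left
one is not.  A period P smaller than the block would move both holes to
positions congruent modulo scale n which are not holes, where the symbols
agree. *)
Lemma nonperiodic_eta_xi : ~ periodic eta_xi.
Proof.
case=> P P0 yP; pose n := P; have Pn : (P <= reach n)%N by exact: (leq_reach P).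
have [h0 hN0] := block_reach n.
set h : int := (reach n)%:Z in h0 hN0.
have hp : (scale n)%:Z = h + h + 1 by rewrite scale_reach /h; lia.
have y1 : eta_xi h = ~~ (xi h (+) xi (- h)).
  rewrite /eta_xi /eta22; have -> : h + 1 = (scale n)%:Z * 1 + - h by lia.
  by rewrite xi_translate // xi_scale //= addNb addbC.
have y2 : eta_xi (- h - 1) = xi h (+) xi (- h).
  rewrite /eta_xi /eta22 subrK.
  have -> : - h - 1 = (scale n)%:Z * -1 + h by lia.
  by rewrite xi_translate // xi_scale //= addbC.
have e : eta_xi (h + P%:Z) = eta_xi (- h - 1 + P%:Z).
  have b0 m : `|m| <= h -> block n m = 0 by move=> ?; apply: block_small; lia.
  have c : block n (- h - 1 + P%:Z + 1) = block n (- h - 1 + P%:Z).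
    by rewrite !b0 //; lia.
  have -> : h + P%:Z = - h - 1 + P%:Z + (scale n)%:Z * 1 by lia.
  rewrite (eta_xi_eq_part c) -(eta_partD n _ 1); apply: eta_xi_eq_part.
  by rewrite addrAC !blockD c.
by move: e; rewrite !yP y1 y2; case: (_ (+) _).
Qed.

(** For n large both m and m + 1 lie in the central block of level n, so m is
not a hole and the symbol at m has period scale n. *)
Lemma toeplitz_eta_xi : toeplitz eta_xi.
Proof.
split=> [|m]; first exact: nonperiodic_eta_xi.
have [n [m0 m10]] := common_block m (m + 1).
exists (scale n) => [|k]; first exact: scale_gt0.
have e : block n (m + 1) = block n m by rewrite m0.
rewrite (eta_xi_eq_part e) -(eta_partD n _ k); apply: eta_xi_eq_part.
by rewrite addrAC !blockD e.
Qed.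

(** * Windows, closures and recurrence *)

(** Windows centred at 0 replace words: each word of w sits in such a window. *)
Lemma subshift_ofP (u w : full_shift) : subshift_of u w <->
  forall L : nat, exists j : int,
    forall v : int, `|v| <= L%:Z -> w v = u (j + v).
Proof.
split=> [uw L|uw s [i ->]].
  have [|i e] := uw [seq w (- L%:Z + k%:Z) | k <- iota 0 (2 * L).+1].
    by exists (- L%:Z); rewrite size_map size_iota.
  exists (i + L%:Z) => v vL.
  rewrite size_map size_iota in e.
  have /eq_in_map/(_ (absz (v + L%:Z))) := e; rewrite mem_iota => /(_ _)/=.
  have -> : - L%:Z + absz (v + L%:Z) = v by lia.
  by move=> -> //; [congr u|]; lia.
have [j uj] := uw (`|i| + size s)%N.
exists (j + i); rewrite size_map size_iota; apply/eq_in_map => k.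
by rewrite mem_iota => ks; rewrite uj ?addrA //; lia.
Qed.

(** The sets containing all points that agree with z on some window form a
filter which converges to z coordinatewise, hence converges to z. *)
Lemma nbhs_window (z : full_shift) (U : set full_shift) : nbhs z U ->
  exists L : nat, forall w : full_shift,
    (forall v : int, `|v| <= L%:Z -> w v = z v) -> U w.
Proof.
pose F : set_system full_shift := [set V | exists L : nat,
  forall w : full_shift, (forall v : int, `|v| <= L%:Z -> w v = z v) -> V w].
have FF : Filter F.
  split.
  - by exists 0%N.
  - move=> V W [L1 h1] [L2 h2]; exists (maxn L1 L2) => w wz.
    by split; [apply: h1|apply: h2] => v vL; apply: wz; lia.
  - by move=> V W VW [L h]; exists L => w /h /VW.
suff : F --> z by exact.
apply/cvg_sup => n V [_ [[W oW <-] /= Wz WV]].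
by exists `|n|%N => w wz; apply: WV => /=; rewrite wz //; lia.
Qed.

Lemma closure_orbitP (z u : full_shift) :
  (forall L : nat, exists k : int,
     forall v : int, `|v| <= L%:Z -> z (v + k) = u v) ->
  closure (shift_orbit z) u.
Proof.
move=> H U /nbhs_window [L UL]; have [k zk] := H L.
exists (shift_iter k z); split; last exact: UL.
by exists k.
Qed.

(** Given i, let l >= i be the next multiple of scale (n + 1).  The blocks of
level n centred at l and at l + scale n carry opposite copies of the central
block, so one of them has the required colour c. *)
Lemma recurrence n (c : bool) (i : int) : exists2 k : int,
  0 <= k < 2 * (scale n.+1)%:Z &
  forall v, block n v = 0 -> xi (i + k + v) = xi v (+) c.
Proof.
set P := scale n.+1; have P0 : (0 < scale n.+1)%N := scale_gt0 _.
have P1 : (scale n < P)%N.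
  rewrite /P /= /base; have := scale_gt0 n; have := radius_gt1 n; nia.
pose a := - ((- i) %/ P%:Z)%Z.
have aP : i <= P%:Z * a < i + P%:Z.
  have PZ : P%:Z != 0 by lia.
  have := modz_ge0 (- i) PZ; have := @ltz_pmod (- i) P%:Z.
  have := divz_eq (- i) P%:Z; rewrite /a.
  move: (_ %/ _)%Z (_ %% _)%Z => d r e /(_ ltac:(by rewrite ltz_nat)) rP r0.
  suff -> : P%:Z * - d = i + r by rewrite lerDl r0 ltrD2l.
  by rewrite mulrN mulrC; lia.
have key (e : bool) v : block n v = 0 ->
    xi (P%:Z * a + ((scale n)%:Z * e%:Z + v)) = xi (P%:Z * a) (+) e (+) xi v.
  move=> v0; rewrite xi_translate; last by rewrite block_scale_next //; case: e.
  rewrite xi_translate // addbA; congr (_ (+) _ (+) _).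
  by case: e; rewrite xi_scale.
pose e := xi (P%:Z * a) (+) c.
exists (P%:Z * a + (scale n)%:Z * e%:Z - i).
  by case: e => /=; lia.
move=> v v0; have := key e v v0.
have -> : i + (P%:Z * a + (scale n)%:Z * e%:Z - i) + v =
   P%:Z * a + ((scale n)%:Z * e%:Z + v) by lia.
by move=> ->; rewrite /e addbA addbb addFb addbC.
Qed.

(** The word of the central block repeated periodically shows no window of
length at most scale n that is absent from xi: at the blocks of index -1 and 0
of level n, and hence at their junction, xi coincides with xi_part n. *)
Lemma xi_part_window n (L : nat) (j : int) : (2 * L < scale n)%N ->
  exists i : int,
    forall v : int, `|v| <= L%:Z -> xi_part n (j + v) = xi (i + v).
Proof.
move=> Ln; pose b := block n (j - L%:Z) + 1.
exists (j - (scale n)%:Z * b) => v vL; set m := _ - _ + v.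
have jvE : j + v = m + (scale n)%:Z * b by rewrite /m [RHS]addrAC subrK.
have mE : block n (m + (scale n)%:Z * b) = block n m + b := blockD _ _ _.
have lb : block n (j - L%:Z) <= block n (j + v) by apply: le_block; lia.
have ub : block n (j + v) <= block n (j - L%:Z + (scale n)%:Z * 1).
  by apply: le_block; lia.
rewrite blockD in ub; rewrite jvE mE /b in lb ub; rewrite jvE xi_partD.
have r := radius_gt1 n.
have m0 : block n.+1 m = 0 by rewrite /= divz_small // /base; lia.
rewrite -(xi_partE m0) /=.
suff -> : flip n m = false by rewrite addbF.
rewrite /flip; have : (block n m == -1) || (block n m == 0) by lia.
case/orP=> /eqP->; last by rewrite mod0z.
by rewrite -modzDl modz_small /base; lia.
Qed.

Lemma sum_periodic (p : nat) (f : int -> nat) (j : int) :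
  (forall m, f (m + p%:Z) = f m) ->
  (\sum_(i < p) f (i%:Z + j)%R = \sum_(i < p) f i%:Z)%N.
Proof.
move=> fp; pose S j := (\sum_(i < p) f (i%:Z + j)%R)%N.
have S1 l : S (l + 1) = S l.
  rewrite /S; case: p fp @S => [|p] fp S; first by rewrite !big_ord0.
  rewrite big_ord_recr big_ord_recl /= addnC; congr (_ + _)%N.
    by rewrite -[RHS]fp; congr f; rewrite /=; lia.
  by apply: eq_bigr => i _; congr f; rewrite /= /bump; lia.
have -> : (\sum_(i < p) f i%:Z)%N = S 0 by apply: eq_bigr => i _; rewrite addr0.
rewrite -[LHS]/(S j); elim: j => [//|k IH|k IH].
  by rewrite -IH -[RHS]S1; congr S; lia.
by rewrite -IH -[LHS]S1; congr S; lia.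
Qed.

Lemma block_step n m : block n m <= block n (m + 1) <= block n m + 1.
Proof.
rewrite le_block ?lerDl //= -(blockD n m 1) le_block // mulr1 lerD2l.
by rewrite lez_nat scale_gt0.
Qed.

(** block n is nondecreasing with steps at most 1 and grows by 1 over a
period. *)
Lemma one_hole n (c : int) :
  (\sum_(i < scale n)
     (block n (i%:Z + c + 1)%R != block n (i%:Z + c)%R))%N = 1%N.
Proof.
suff : \sum_(i < scale n) (block n (i%:Z + c + 1) - block n (i%:Z + c)) = 1.
  move=> e; apply/eqP; rewrite -eqz_nat (big_morph Posz PoszD (erefl 0%:Z)).
  apply/eqP; rewrite -[RHS]e; apply: eq_bigr => i _.
  have := block_step n (i%:Z + c).
  by case: eqVneq => /=; lia.
pose f k := block n (k%:Z + c).
rewrite (eq_bigr (fun i : 'I__ => f i.+1 - f i)); last first.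
  by move=> i _; rewrite /f; congr (block n _ - _); lia.
rewrite -(big_mkord xpredT (fun k => f k.+1 - f k)) telescope_sumr //.
by rewrite /f add0r [_ + c]addrC -[X in c + X]mulr1 blockD addrAC subrr add0r.
Qed.

(** * Frequencies of local patterns *)

Definition depends_on (s : seq int) (A : set full_shift) :=
  forall z w : full_shift, (forall i, i \in s -> z i = w i) -> A z -> A w.

(** In a stretch of length scale n, a point of the orbit closure differs from
the periodic sequence only at its single hole, so each of the coordinates in s
spoils at most one visit. *)
Lemma sum_visits (s : seq int) (A : set full_shift) n (w : full_shift) :
  depends_on s A -> subshift_of eta_xi w ->
  (\sum_(i < scale n) (shift_iter i%:Z w \in A) <=
   \sum_(i < scale n) (shift_iter i%:Z (eta22 (xi_part n)) \in A) + size s)%N.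
Proof.
move=> As /subshift_ofP/(_ (scale n + \sum_(c <- s) `|c|)%N)[j wj].
pose f (i : int) : nat := shift_iter i (eta22 (xi_part n)) \in A.
have fP m : f (m + (scale n)%:Z) = f m.
  rewrite /f; congr (nat_of_bool (_ \in A)); apply/funext => k.
  by rewrite /shift_iter addrA -[X in _ + X]mulr1 eta_partD.
pose hole (c i : int) : nat := block n (i + c + 1) != block n (i + c).
rewrite -(@sum_periodic _ f j fP).
have -> : size s = (\sum_(i < scale n) \sum_(c <- s) hole (c + j)%R i%:Z)%N.
  rewrite exchange_big /= (eq_bigr (fun=> 1%N)) ?sum1_size// => c _.
  exact: one_hole.
rewrite -big_split /=; apply: leq_sum => i _.
case: (boolP (_ \in A)) => //; rewrite inE => Aw.
case: posnP => [|//]; move/eqP; rewrite addn_eq0 => /andP[fi].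
rewrite sum_nat_seq_eq0 => /allP nohole.
suff : A (shift_iter (i%:Z + j) (eta22 (xi_part n))).
  by move=> /mem_set Af; rewrite /f Af in fi.
apply: As Aw => c cs.
have cL : (`|c| <= \sum_(c <- s) `|c|)%N.
  by rewrite (big_rem c) //= leq_addr.
rewrite /shift_iter wj; last by have := ltn_ord i; lia.
have /nohole/= := cs; rewrite eqb0 negbK => /eqP h.
rewrite (eta_xi_eq_part (n := n)).
  by congr (eta22 _ _); lia.
by rewrite (_ : j + (c + i%:Z) = i%:Z + (c + j)) //; lia.
Qed.

(** * Minimality of the orbit closure and of its preimage *)

Lemma eta22_inj_xor (L : nat) (z u : full_shift) :
  (forall v : int, `|v| <= L%:Z -> eta22 z v = eta22 u v) ->
  forall v : int, `|v| <= L%:Z -> z v = u v (+) (z 0 (+) u 0).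
Proof.
move=> zu; elim=> [|k IH|k IH] kL.
- by rewrite addbC -addbA addbb addbF.
- have kL' : `|k%:Z| <= L%:Z by lia.
  have zk := IH kL'.
  have := zu k%:Z kL'; rewrite /eta22 zk (_ : k%:Z + 1 = k.+1%:Z); last lia.
  by move: (z k.+1%:Z) (u k.+1%:Z) (u k%:Z) (z 0) (u 0) => [] [] [] [] [].
have kL' : `|- k%:Z| <= L%:Z by lia.
have := zu (- k.+1%:Z) kL.
rewrite /eta22 (_ : - k.+1%:Z + 1 = - k%:Z); last lia.
rewrite (IH kL').
by move: (z _) (u (- k.+1%:Z)) (u (- k%:Z)) (z 0) (u 0) => [] [] [] [] [].
Qed.

Lemma minimal_eta_xi : minimal (subshift_of eta_xi).
Proof.
move=> z /subshift_ofP zP u /subshift_ofP uP; apply: closure_orbitP => L.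
have [j uj] := uP L.
pose n := (`|j| + L).+1.
have n0 m : `|m| <= n%:Z -> block n m = 0.
  by move=> mn; apply: block_small; have := leq_reach n; lia.
have [i zi] := zP (2 * scale n.+1 + n)%N.
have [k kP xik] := recurrence n false i.
exists (k + j) => v vL.
rewrite zi ?uj //; last by lia.
rewrite /eta_xi /eta22.
have -> : i + (v + (k + j)) = i + k + (j + v) by lia.
by rewrite -[i + k + _ + 1]addrA !xik ?addbF ?n0 //; lia.
Qed.

Lemma preimage_eta_xiP (z : full_shift) : subshift_of eta_xi (eta22 z) <->
  forall L : nat, exists j : int, exists c : bool,
    forall v : int, `|v| <= L%:Z -> z v = xi (j + v) (+) c.
Proof.
split=> [/subshift_ofP zP L|zP].
  have [j zj] := zP L; exists j, (z 0 (+) xi (j + 0)).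
  apply: (@eta22_inj_xor L z (fun v => xi (j + v))) => v vL.
  by rewrite zj // /eta_xi /eta22 addrA.
apply/subshift_ofP => L; have [j [c zj]] := zP L.+1.
exists j => v vL; rewrite /eta22 !zj; try lia.
by rewrite addbACA addbb addbF /eta_xi /eta22 addrA.
Qed.

Lemma minimal_preimage_eta_xi : minimal (eta22 @^-1` (subshift_of eta_xi)).
Proof.
move=> z /preimage_eta_xiP zP u /preimage_eta_xiP uP.
apply: closure_orbitP => L.
have [j [c uj]] := uP L.
pose n := (`|j| + L)%N.
have n0 m : `|m| <= n%:Z -> block n m = 0.
  by move=> mn; apply: block_small; have := leq_reach n; lia.
have [i [d zi]] := zP (2 * scale n.+1 + n)%N.
have [k kP xik] := recurrence n (c (+) d) i.
exists (k + j) => v vL.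
rewrite zi ?uj //; last by lia.
have -> : i + (v + (k + j)) = i + k + (j + v) by lia.
by rewrite xik ?n0 -?addbA ?addbb ?addbF //; lia.
Qed.

(** * Borel sets of the full shift *)

(** Induction on the coordinates: the symbol at the first coordinate splits the
set into two parts which depend on the remaining ones. *)
Lemma preimage_depends_measurable (d : measure_display) (T : measurableType d)
    (f : T -> full_shift) (s : seq int) (A : set full_shift) :
  (forall m, measurable [set t | f t m]) -> depends_on s A ->
  measurable (f @^-1` A).
Proof.
move=> mf; elim: s A => [|m s IH] A As.
  have [[z Az]|nA] := pselect (exists z, A z).
    rewrite (_ : _ @^-1` _ = setT) // -subTset => t _; exact: As Az.
  rewrite (_ : _ @^-1` _ = set0) // -subset0 => t At.
  by apply: nA; exists (f t).
pose upd (b : bool) (z : full_shift) : full_shift :=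
  fun i => if i == m then b else z i.
have updE b z : z m = b -> upd b z = z.
  by move=> zm; apply/funext => i; rewrite /upd; case: eqP => // ->.
have mA b : measurable (f @^-1` (upd b @^-1` A)).
  apply: IH => z w zw; apply: As => i; rewrite inE /upd.
  by case: eqVneq => //= _; exact: zw.
rewrite (_ : f @^-1` A = ([set t | f t m] `&` f @^-1` (upd true @^-1` A)) `|`
    (~` [set t | f t m] `&` f @^-1` (upd false @^-1` A))).
  by apply: measurableU; apply: measurableI => //; exact: measurableC.
apply/seteqP; split=> t /=.
  by case E : (f t m) => At; [left|right]; rewrite updE // E.
case=> -[]; first by move=> E; rewrite updE.
by move=> /negP/negbTE E; rewrite updE.
Qed.

Definition window (L : nat) : seq int :=
  [seq k%:Z - L%:Z | k <- iota 0 (2 * L).+1].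

Lemma mem_window L (v : int) : (v \in window L) = (`|v| <= L%:Z).
Proof.
apply/mapP/idP => [[k]|vL].
  by rewrite mem_iota => kL ->; lia.
by exists (absz (v + L%:Z)); [rewrite mem_iota|]; lia.
Qed.

(** The L-th set consists of the points whose whole cylinder over the window of
radius L lies in U. *)
Lemma open_bigcup_depends (U : set full_shift) : open U ->
  exists F : nat -> set full_shift,
    (forall L, depends_on (window L) (F L)) /\ U = \bigcup_L F L.
Proof.
move=> oU; exists (fun L => [set z : full_shift | forall w : full_shift,
  (forall v, v \in window L -> w v = z v) -> U w]); split.
  move=> L z z' zz' Hz w wz'; apply: Hz => v vL.
  by rewrite wz' // zz'.
apply/seteqP; split=> [z Uz|z [L _]]; last exact.
have /nbhs_window[L HL] : nbhs z U by exact: open_nbhs_nbhs.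
by exists L => // w wz; apply: HL => v vL; apply: wz; rewrite mem_window.
Qed.

Lemma coord_measurable (m : int) :
  measurable ([set z : full_shift | z m] : set borel_full_shift).
Proof.
apply: sub_sigma_algebra => /=; rewrite openE => z /= zm.
rewrite /interior; near=> w.
by rewrite /= (_ : w m = z m) //; near: w; exact: nbhs_coord.
Unshelve. all: by end_near. Qed.

Lemma depends_measurable s (A : set full_shift) : depends_on s A ->
  measurable (A : set borel_full_shift).
Proof.
exact:
  (@preimage_depends_measurable _ borel_full_shift id s A coord_measurable).
Qed.

(** The clopen sets; they form a pi-system generating the Borel sets, and are
easier to handle than cylinders since no word has to be named. *)
Definition local_sets : set (set full_shift) :=
  [set A | exists s, depends_on s A].

Lemma borel_local_sets :
  @measurable _ borel_full_shift = <<s local_sets >>.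
Proof.
apply/seteqP; split.
  apply: smallest_sub; first exact: smallest_sigma_algebra.
  move=> U /open_bigcup_depends[F [dF ->]].
  apply: sigma_algebra_bigcup => L; apply: sub_sigma_algebra.
  by exists (window L); exact: dF.
apply: smallest_sub; first exact: sigma_algebra_measurable.
by move=> A [s]; exact: depends_measurable.
Qed.

Lemma setI_closed_local_sets : setI_closed local_sets.
Proof.
move=> A B [s sA] [t tB]; exists (s ++ t) => z w zw [Az Bz]; split.
  by apply: sA Az => i si; apply: zw; rewrite mem_cat si.
by apply: tB Bz => i ti; apply: zw; rewrite mem_cat ti orbT.
Qed.

Lemma local_setT : local_sets setT.
Proof. by exists [::]. Qed.

Lemma probability_eq_local (R : realType)
    (mu nu : probability borel_full_shift R) :
  (forall s A, depends_on s A -> mu A = nu A) ->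
  forall A : set borel_full_shift, measurable A -> mu A = nu A.
Proof.
move=> munu A mA.
apply: (@measure_unique _ R borel_full_shift local_sets (fun=> setT)
  borel_local_sets setI_closed_local_sets _ _ mu nu) => //.
- by move=> _; exact: local_setT.
- exact: bigcup_const.
- by move=> B [s]; exact: munu.
- by move=> _; rewrite /= probability_setT ltry.
Qed.

Lemma measurable_fun_coord (d : measure_display) (T : measurableType d)
    (f : T -> borel_full_shift) :
  (forall m, measurable [set t | (f t : full_shift) m]) ->
  measurable_fun setT f.
Proof.
move=> mf; apply: (@measurability _ _ T borel_full_shift setT f local_sets
  borel_local_sets).
move=> _ [A [s As] <-]; rewrite setTI.
exact: (preimage_depends_measurable mf As).
Qed.

Lemma measurable_local_map (f : full_shift -> full_shift) (N : int -> seq int) :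
  (forall m z w, (forall i, i \in N m -> z i = w i) -> f z m = f w m) ->
  measurable_fun setT (f : borel_full_shift -> borel_full_shift).
Proof.
move=> fN; apply: measurable_fun_coord => m.
by apply: (@depends_measurable (N m)) => z w /fN /= ->.
Qed.

Lemma measurable_shift :
  measurable_fun setT (shift : borel_full_shift -> borel_full_shift).
Proof.
apply: (@measurable_local_map _ (fun m => [:: m + 1])) => m z w; apply.
by rewrite inE.
Qed.

Lemma measurable_eta22 :
  measurable_fun setT (eta22 : borel_full_shift -> borel_full_shift).
Proof.
apply: (@measurable_local_map _ (fun m => [:: m + 1; m])) => m z w zw.
by rewrite /eta22 !zw ?inE ?eqxx ?orbT.
Qed.

Definition complement (z : full_shift) : full_shift := fun m => ~~ z m.

Lemma measurable_complement :
  measurable_fun setT (complement : borel_full_shift -> borel_full_shift).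
Proof.
apply: (@measurable_local_map _ (fun m => [:: m])) => m z w zw.
by rewrite /complement zw ?inE.
Qed.

Lemma subshift_measurable (X : set full_shift) : subshift X ->
  measurable (X : set borel_full_shift).
Proof.
move=> [clX _]; rewrite -(setCK (X : set borel_full_shift)); apply: measurableC.
by apply: sub_sigma_algebra; exact: closed_openC.
Qed.

Lemma image_probability (R : realType) (d : measure_display)
    (T : measurableType d) (P : probability T R) (f : T -> borel_full_shift) :
  measurable_fun setT f ->
  exists mu : probability borel_full_shift R, forall A, mu A = P (f @^-1` A).
Proof.
move=> mf; pose X : {mfun T >-> borel_full_shift} :=
  HB.pack f (@isMeasurableFun.Build _ _ T borel_full_shift f mf).
by exists (distribution P X).
Qed.

(** * Unique ergodicity of the Toeplitz subshift *)

Lemma shift_iter_nat (k : nat) : shift_iter k%:Z = iter k shift.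
Proof.
elim: k => [|k IH]; first exact: shift_iter0.
by rewrite intS shift_iterD IH shift_iter1.
Qed.

Lemma invariant_iter (R : realType) (X : set full_shift)
    (nu : probability borel_full_shift R) (A : set borel_full_shift) (k : nat) :
  invariant_probability X nu -> measurable A ->
  measurable (shift_iter k%:Z @^-1` A : set borel_full_shift) /\
  nu (shift_iter k%:Z @^-1` A) = nu A.
Proof.
move=> [_ inv] mA; elim: k => [|k [mk IH]]; first by rewrite shift_iter0.
have e : shift_iter k.+1%:Z @^-1` A = shift @^-1` (shift_iter k%:Z @^-1` A).
  by apply/seteqP; split=> z; rewrite /= !shift_iter_nat iterSr.
rewrite e inv //; split=> //.
by rewrite -[X in measurable X]setTI; exact: measurable_shift.
Qed.

Lemma probability_setI_full (d : measure_display) (T : measurableType d)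
    (R : realType) (P : probability T R) (X B : set T) :
  measurable X -> measurable B -> P X = 1%E -> P (B `&` X) = P B.
Proof.
move=> mX mB PX.
have PXC : P (~` X) = 0%E by rewrite probability_setC // PX subee.
have mBX : measurable (B `\` X) by exact: measurableD.
have PBX : P (B `\` X) = 0%E.
  apply/eqP; rewrite eq_le measure_ge0 andbT -PXC.
  by apply: le_measure; rewrite ?inE //; exact: measurableC.
apply/eqP; rewrite eq_le; apply/andP; split.
  by apply: le_measure; rewrite ?inE //; exact: measurableI.
rewrite -[leLHS](congr1 P (setUIDK B X)) -[leRHS]adde0 -PBX.
by apply: measureU2 => //; exact: measurableI.
Qed.

(** Integrate the sum of the indicators. *)
Lemma sum_probability_le (d : measure_display) (T : measurableType d)
    (R : realType) (P : probability T R) (p c : nat) (B : 'I_p -> set T) :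
  (forall i, measurable (B i)) ->
  (forall t, (\sum_(i < p) (t \in B i) <= c)%N) ->
  (\sum_(i < p) P (B i) <= c%:R%:E)%E.
Proof.
move=> mB Bc.
rewrite (eq_bigr (fun i => \int[P]_(t in setT) (\1_(B i) t)%:E)%E); last first.
  by move=> i _; rewrite integral_indic // setIT.
have mI i := (measurable_realfun.measurable_EFinP _ _).2
  (@measurable_realfun.measurable_indic _ T R setT _ (mB i)).
rewrite -ge0_integral_sum //.
have -> : (c%:R%:E = \int[P]_(t in setT) (cst c%:R%:E) t :> \bar R)%E.
  rewrite integral_cst // -[LHS]mule1; congr (_ * _)%E.
  by rewrite -(probability_setT P).
apply: ge0_le_integral => //.
- by move=> t _; apply: sume_ge0 => i _; rewrite lee_fin.
- exact: emeasurable_sum.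
move=> t _; rewrite sumEFin lee_fin /cst.
apply: le_trans (_ : (\sum_(i < p) (t \in B i))%:R <= _); last first.
  by rewrite ler_nat.
by rewrite natr_sum; apply: ler_sum => i _; rewrite indicE.
Qed.

(** The preimages of A under the first p iterates of the shift have the same
measure, and each point of X lies in at most c of them. *)
Lemma visits_bound (R : realType) (X : set full_shift)
    (nu : probability borel_full_shift R) (A : set borel_full_shift)
    (p c : nat) :
  subshift X -> invariant_probability X nu -> measurable A ->
  (forall z, X z -> (\sum_(i < p) (shift_iter i%:Z z \in A) <= c)%N) ->
  p%:R * fine (nu A) <= c%:R.
Proof.
move=> /subshift_measurable mX nuI mA Xc.
pose B (i : 'I_p) : set borel_full_shift := (shift_iter i%:Z @^-1` A) `&` X.
have mB i : measurable (B i).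
  by apply: measurableI => //; have [] := invariant_iter i nuI mA.
have nuB i : nu (B i) = nu A.
  have [mi <-] := invariant_iter i nuI mA.
  by apply: probability_setI_full => //; case: nuI.
rewrite -lee_fin.
have -> : (p%:R * fine (nu A))%:E = (\sum_(i < p) nu (B i))%E.
  rewrite (eq_bigr (fun=> (fine (nu A))%:E)) => [|i _].
    by rewrite sumEFin sumr_const card_ord mulr_natl.
  by rewrite fineK ?nuB // fin_num_measure.
apply: sum_probability_le => // z.
have [Xz|nXz] := pselect (X z); last first.
  by rewrite big1 // => i _; rewrite memNset // => -[_]; exact: nXz.
apply: leq_trans (Xc z Xz); apply: leq_sum => i _.
by case: (boolP (z \in B i)) => //; rewrite inE => -[Az _]; rewrite mem_set.
Qed.

Lemma visitsC (A : set full_shift) (p : nat) (z : full_shift) :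
  (\sum_(i < p) (shift_iter i%:Z z \in ~` A) =
   p - \sum_(i < p) (shift_iter i%:Z z \in A))%N.
Proof.
have e : (\sum_(i < p) ((shift_iter i%:Z z \in ~` A) +
    (shift_iter i%:Z z \in A)) = p)%N.
  rewrite (eq_bigr (fun=> 1%N)) ?sum1_card ?card_ord // => i _.
  by rewrite in_setC; case: (_ \in A).
by rewrite -[X in (X - _)%N]e big_split /= addnK.
Qed.

Lemma depends_onC s A : depends_on s A -> depends_on s (~` A).
Proof. by move=> As z w zw nAz Aw; apply/nAz/(As w) => // i /zw. Qed.

(** The number of visits along scale n steps is known up to size s, for A and
for its complement; the first bounds mu A from above, the second nu A from
below, with an error 2 * size s / scale n. *)
Lemma invariant_eta_xi_le (R : realType)
    (mu nu : probability borel_full_shift R) s A :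
  invariant_probability (subshift_of eta_xi) mu ->
  invariant_probability (subshift_of eta_xi) nu ->
  depends_on s A -> fine (mu A) <= fine (nu A).
Proof.
move=> muI nuI As; have mA := depends_measurable As.
have sY := subshift_subshift_of eta_xi.
have bound n : (scale n)%:R * (fine (mu A) - fine (nu A)) <= (2 * size s)%N%:R.
  pose c := (\sum_(i < scale n) (shift_iter i%:Z (eta22 (xi_part n)) \in A))%N.
  have cp : (c <= scale n)%N.
    rewrite -[X in (_ <= X)%N]card_ord -sum1_card; apply: leq_sum => i _.
    exact: leq_b1.
  have := visits_bound sY muI mA (fun z => sum_visits n As).
  have := visits_bound sY nuI (measurableC mA)
    (fun z => sum_visits n (depends_onC As)).
  rewrite visitsC -/c.
  have -> : fine (nu (~` A)) = 1 - fine (nu A).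
    by rewrite probability_setC // fineB ?fin_num_measure.
  rewrite natrM !natrD natrB //; lra.
rewrite leNgt -subr_gt0; apply/negP => d0.
set d := _ - _ in bound d0.
pose n := (Num.truncn ((2 * size s)%N%:R / d)).+1.
have := bound n; apply/negP; rewrite -ltNge.
rewrite -ltr_pdivrMr //; apply: lt_le_trans (_ : n%:R <= _).
  by rewrite truncnS_gt.
by rewrite ler_nat scale_reach; have := leq_reach n; lia.
Qed.

Lemma unique_invariant_eta_xi (R : realType)
    (mu nu : probability borel_full_shift R) :
  invariant_probability (subshift_of eta_xi) mu ->
  invariant_probability (subshift_of eta_xi) nu ->
  forall A : set borel_full_shift, measurable A -> nu A = mu A.
Proof.
move=> muI nuI; apply: probability_eq_local => s A As.
have mA := depends_measurable As.
rewrite -[LHS]fineK ?fin_num_measure // -[RHS]fineK ?fin_num_measure //.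
by congr EFin; apply: le_anti; rewrite !(@invariant_eta_xi_le _ _ _ s).
Qed.

(** * A random point of the odometer *)

(** J n is the residue modulo scale n of a random element of the inverse limit
of the groups Z / scale n, distributed according to Haar measure. *)
Definition uniform_residues (d : measure_display) (T : measurableType d)
    (R : realType) (P : probability T R) (J : nat -> T -> nat) : Prop :=
  [/\ forall n j, measurable [set t | J n t = j],
      forall n j, (j < scale n)%N ->
        P [set t | J n t = j] = ((scale n)%:R^-1)%:E,
      forall n t, (J n t < scale n)%N
    & forall n t, J n.+1 t = J n t %[mod scale n]].

Section Limit.
Context (d : measure_display) (T : measurableType d) (R : realType)
  (P : probability T R) (J : nat -> T -> nat).
Hypothesis JU : uniform_residues P J.

Lemma residue_law n (f : pred nat) : measurable [set t | f (J n t)] /\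
  P [set t | f (J n t)] = ((\sum_(j < scale n) f j)%N%:R / (scale n)%:R)%:E.
Proof.
have [Jm JP Jlt _] := JU.
pose F j : set T :=
  if f j && (j < scale n)%N then [set t | J n t = j] else set0.
have mF j : measurable (F j) by rewrite /F; case: ifP.
have tF : trivIset setT F.
  apply/trivIsetP => i j _ _ /eqP ij; rewrite -subset0 => t []; rewrite /F.
  by case: ifP => // _ /= Ji; case: ifP => // _ /= Jj; apply: ij; rewrite -Ji.
have -> : [set t | f (J n t)] = \big[setU/set0]_(i < scale n) F i.
  rewrite -bigcup_mkord; apply/seteqP; split=> [t /= ft|t [j /= jn]].
    by exists (J n t) => //=; rewrite /F ft Jlt.
  by rewrite /F jn andbT; case: ifP => // fj /= ->.
split; first exact: bigsetU_measurable.
rewrite measure_bigsetU //.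
transitivity (\sum_(i < scale n) ((f i)%:R / (scale n)%:R)%:E : \bar R)%E.
  apply: eq_bigr => i _; rewrite /F ltn_ord andbT.
  by case: (f i) => /=; [rewrite JP // mul1r|rewrite measure0 mul0r].
by rewrite sumEFin -mulr_suml -natr_sum.
Qed.

(** The residue J n t is the position, relative to the centre of a block of
level n, of coordinate 0 of the point attached to t. *)
Definition stage n (t : T) : full_shift := shift_iter (J n t)%:Z (xi_part n).

(** Eventual truth defines the limit everywhere, also at the points where the
stages do not converge, and makes it measurable. *)
Definition limit_point (t : T) : full_shift :=
  fun m => `[< exists N, forall n, (N <= n)%N -> stage n t m >].

Definition change n m : set T := [set t | flip n (m + (J n.+1 t)%:Z)].

Lemma change_measurable n m : measurable (change n m).
Proof. by have [] := residue_law n.+1 (fun j => flip n (m + j%:Z)). Qed.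

(** The residues J n and J (n + 1) agree modulo the period of xi_part n, so that
only the digit of rank n can change the symbol. *)
Lemma stageS n t m : stage n.+1 t m = stage n t m (+) `[< change n m t >].
Proof.
have [_ _ _ /(_ n t) JS] := JU.
rewrite /stage /shift_iter /= /change /= asboolb; congr (_ (+) _).
rewrite (divn_eq (J n.+1 t) (scale n)) JS [in RHS](divn_eq (J n t) (scale n)).
rewrite !PoszD !PoszM ![_ * (scale n)%:Z]mulrC.
by rewrite ![(scale n)%:Z * _ + _]addrC !addrA !xi_partD.
Qed.

(** For each residue r modulo scale n, exactly one of the base n numbers below
scale (n + 1) congruent to r has the digit 1 at m + j. *)
Lemma card_flip n m : (\sum_(j < scale n.+1) flip n (m + j%:Z) <= scale n)%N.
Proof.
rewrite -big_mkcond /= sum1_card.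
pose r (j : 'I_(scale n.+1)) : 'I_(scale n) :=
  Ordinal (ltn_pmod j (scale_gt0 n)).
rewrite -[X in (_ <= X)%N]card_ord; apply: (@leq_card_in _ _ r).
move=> i j fi fj /(congr1 val)/= eij.
have {}fi : flip n (m + i%:Z) by exact: fi.
have {}fj : flip n (m + j%:Z) by exact: fj.
have quo (k : 'I_(scale n.+1)) : (k %/ scale n < base n)%N.
  by rewrite ltn_divLR ?scale_gt0 // mulnC; exact: ltn_ord.
have blk (k : 'I_(scale n.+1)) : block n (m + k%:Z) =
    block n (m + (k %% scale n)%N%:Z) + (k %/ scale n)%N%:Z.
  by rewrite -blockD {1}(divn_eq k (scale n)) PoszD PoszM; congr block; lia.
move: fi fj; rewrite /flip !blk eij => /eqP fi /eqP fj.
have /eqP : (block n (m + (j %% scale n)%N%:Z) + (i %/ scale n)%N%:Z =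
  block n (m + (j %% scale n)%N%:Z) + (j %/ scale n)%N%:Z %[mod (base n)%:Z])%Z.
  by rewrite fi fj.
rewrite eqz_modDl => /eqP.
rewrite !modz_small ?lez_nat ?ltz_nat ?quo // => -[eq]; apply: val_inj.
by rewrite /= (divn_eq i (scale n)) (divn_eq j (scale n)) eij eq.
Qed.

Lemma radiusE n : (2 * radius n = 2 ^ n.+3)%N.
Proof. by rewrite /radius -expnS. Qed.

Lemma change_le n m : (P (change n m) <= ((2 ^ n.+3)%N%:R^-1)%:E)%E.
Proof.
have [_ ->] := residue_law n.+1 (fun j => flip n (m + j%:Z)).
rewrite lee_fin ler_pdivrMr ?ltr0n ?scale_gt0 //.
apply: (@le_trans _ _ (scale n)%:R); first by rewrite ler_nat card_flip.
rewrite mulrC ler_pdivlMr ?ltr0n ?expn_gt0 // -natrM ler_nat.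
by rewrite /= leq_mul2l -radiusE /base leqnSn orbT.
Qed.

Definition late_change n m : set T := \bigcup_k change (n + k) m.

Lemma late_change_measurable n m : measurable (late_change n m).
Proof. by apply: bigcupT_measurable => k; exact: change_measurable. Qed.

(** Summation of change_le over the ranks from n on. *)
Lemma late_change_le n m : (P (late_change n m) <= ((2 ^ n.+2)%N%:R^-1)%:E)%E.
Proof.
have e0 : 0 <= (2 ^ n.+2)%N%:R^-1 :> R by rewrite invr_ge0 ler0n.
apply: le_trans (epsilon_trick0 xpredT e0).
have Boole := generalized_Boole_inequality P
  (fun k => change_measurable (n + k) m) (late_change_measurable n m).
apply: (le_trans Boole); apply: lee_nneseries => [k _ _|k _].
  exact: measure_ge0.
apply: (le_trans (change_le _ _)).
rewrite -invfM -natrM -expnD.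
by rewrite (_ : (n + k).+3 = (n.+2 + k.+1)%N) ?lexx //; lia.
Qed.

Lemma stage_stable n m t : ~ late_change n m t ->
  forall n', (n <= n')%N -> stage n' t m = stage n t m.
Proof.
move=> nD; elim=> [|n' IH]; first by rewrite leqn0 => /eqP->.
rewrite leq_eqVlt => /predU1P[->//|nn']; rewrite stageS IH //.
rewrite asboolF ?addbF // => cn; apply: nD; exists (n' - n)%N => //.
by rewrite subnKC.
Qed.

Lemma limit_point_stage n m t : ~ late_change n m t ->
  limit_point t m = stage n t m.
Proof.
move=> /stage_stable st; apply/asboolP/idP => [[N HN]|sm].
  by rewrite -(st (n + N)%N) ?leq_addr // HN ?leq_addl.
by exists n => n' /st ->.
Qed.

Lemma stage_measurable n s A : depends_on s A -> measurable (stage n @^-1` A).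
Proof.
move=> As; apply: preimage_depends_measurable As => m.
by have [] := residue_law n (fun j => xi_part n (m + j%:Z)).
Qed.

Lemma limit_coord_measurable m : measurable [set t | limit_point t m].
Proof.
rewrite (_ : [set t | _] = \bigcup_N \bigcap_n [set t | stage (N + n) t m]).
  apply: bigcupT_measurable => N; apply: bigcapT_measurable => n.
  by have [] := residue_law (N + n) (fun j => xi_part (N + n) (m + j%:Z)).
apply/seteqP; split=> t /=.
  by move=> /asboolP[N HN]; exists N => // n _; apply: HN; rewrite leq_addr.
move=> [N _ HN]; apply/asboolP; exists N => n Nn.
by have := HN (n - N)%N Logic.I; rewrite /= subnKC.
Qed.

Lemma limit_point_measurable :
  measurable_fun setT (limit_point : T -> borel_full_shift).
Proof. by apply: measurable_fun_coord; exact: limit_coord_measurable. Qed.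

Definition late_changes n (s : seq int) : set T :=
  \big[setU/set0]_(m <- s) late_change n m.

Lemma late_changes_measurable n s : measurable (late_changes n s).
Proof. by apply: bigsetU_measurable => m _; exact: late_change_measurable. Qed.

Lemma late_changes_le n s :
  (P (late_changes n s) <= ((size s)%:R / (2 ^ n.+2)%N%:R)%:E)%E.
Proof.
rewrite /late_changes; elim: s => [|m s IH].
  by rewrite big_nil measure0 mul0r.
have U2 :=
  measureU2 P (late_change_measurable n m) (late_changes_measurable n s).
rewrite big_cons; apply: (le_trans U2).
rewrite /= -addn1 natrD mulrDl mul1r addrC EFinD.
by apply: leeD => //; exact: late_change_le.
Qed.

Lemma limit_point_stages n s t : ~ late_changes n s t ->
  forall m, m \in s -> limit_point t m = stage n t m.
Proof.
move=> nD m ms; apply: limit_point_stage => Dm; apply: nD.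
rewrite /late_changes; elim: s ms => // m' s IH; rewrite inE big_cons.
by case/predU1P => [<-|/IH]; [left|right].
Qed.

(** Off the rare event late_changes n s the limit and stage n agree on s. *)
Lemma limit_law_le n s A : depends_on s A ->
  (P (limit_point @^-1` A) <=
   P (stage n @^-1` A) + ((size s)%:R / (2 ^ n.+2)%N%:R)%:E)%E.
Proof.
move=> As.
have U2 := measureU2 P (stage_measurable n As) (late_changes_measurable n s).
apply: (@le_trans _ _ (P (stage n @^-1` A) + P (late_changes n s))%E).
  apply: le_trans U2.
  apply: le_measure; rewrite ?inE.
  - exact: preimage_depends_measurable limit_coord_measurable As.
  - apply: measurableU; first exact: stage_measurable As.
    exact: late_changes_measurable.
  move=> t At; have [|nD] := pselect (late_changes n s t); first by right.
  by left; apply: As At => m ms /=; exact: limit_point_stages nD _ ms.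
by apply: leeD => //; exact: late_changes_le.
Qed.

Lemma stage_law n A : P (stage n @^-1` A) =
  ((\sum_(j < scale n) (shift_iter j%:Z (xi_part n) \in A))%N%:R /
     (scale n)%:R)%:E.
Proof.
have [_ <-] := residue_law n (fun j => shift_iter j%:Z (xi_part n) \in A).
by congr (P _); apply/seteqP; split=> t /=; rewrite inE.
Qed.

(** The stage n is a uniformly chosen shift of a sequence of period scale n, so
its law is exactly invariant. *)
Lemma stage_law_shift n A :
  P (stage n @^-1` (shift @^-1` A)) = P (stage n @^-1` A).
Proof.
rewrite !stage_law; congr ((_%:R / _)%:E).
pose f (j : int) : nat := shift_iter j (xi_part n) \in A.
rewrite -[RHS](@sum_periodic _ f 1) => [|j].
  apply: eq_bigr => j _; rewrite /f; congr nat_of_bool.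
  have e : shift (shift_iter j%:Z (xi_part n)) =
      shift_iter (j%:Z + 1) (xi_part n).
    by rewrite addrC shift_iterD shift_iter1.
  by apply/idP/idP; rewrite !inE /= e.
rewrite /f; congr (nat_of_bool (_ \in A)); apply/funext => k.
by rewrite /shift_iter addrA -[X in _ + X]mulr1 xi_partD.
Qed.

Lemma depends_on_shift s A : depends_on s A ->
  depends_on [seq i + 1 | i <- s] (shift @^-1` A).
Proof.
move=> As z w zw; apply: As => i si; rewrite /shift.
by apply: zw; apply/mapP; exists i.
Qed.

Lemma small_enough (N c : nat) (e : R) : 0 < e ->
  exists2 n : nat, (N <= n)%N & c%:R / (2 ^ n.+2)%N%:R <= e.
Proof.
move=> e0; pose k := Num.truncn (c%:R / e).
exists (N + k)%N; first exact: leq_addr.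
rewrite ler_pdivrMr ?ltr0n ?expn_gt0 // mulrC -ler_pdivrMr //.
apply/ltW/(@lt_le_trans _ _ k.+1%:R); first by rewrite truncnS_gt.
rewrite ler_nat; apply: leq_trans (ltn_expl k (isT : (1 < 2)%N)) _.
by rewrite leq_exp2l //; lia.
Qed.

(** Both sides are approximated by the same number with an error at most
size s / 2 ^ (n + 2).  Equality follows by passing to the complement. *)
Lemma limit_law_shift_le s A : depends_on s A ->
  (P (limit_point @^-1` (shift @^-1` A)) <= P (limit_point @^-1` A))%E.
Proof.
move=> As; apply/lee_addgt0Pr => e e0.
have [n _ ne] := small_enough 0 (size s + size s) e0.
have AsC := depends_onC As.
have mL := preimage_depends_measurable limit_coord_measurable As.
have mS := stage_measurable n As.
have h1 := limit_law_le n (depends_on_shift As).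
have h2 := limit_law_le n AsC.
rewrite stage_law_shift size_map in h1.
have LC : P (limit_point @^-1` (~` A)) = (1 - P (limit_point @^-1` A))%E.
  exact: (probability_setC P mL).
have SC : P (stage n @^-1` (~` A)) = (1 - P (stage n @^-1` A))%E.
  exact: (probability_setC P mS).
rewrite LC SC in h2.
move: h1 h2 ne; rewrite natrD mulrDl.
set c := _ / _.
set x := P _; set y' := P (stage n @^-1` A); set z := P (limit_point @^-1` A).
have fx : x \is a fin_num.
  apply: fin_num_measure.
  exact: preimage_depends_measurable limit_coord_measurable
    (depends_on_shift As).
have fy : y' \is a fin_num by exact: fin_num_measure.
have fz : z \is a fin_num by exact: fin_num_measure.
rewrite -(fineK fx) -(fineK fy) -(fineK fz) -!EFinB -!EFinD !lee_fin.
lra.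
Qed.

(** The preimage subshift is the intersection of the clopen sets XL of points
whose window of radius L occurs in xi or in its complement; a stage n with
scale n > 2 L lies in XL, so the limit lies in XL almost surely. *)
Lemma limit_measure : exists mu : probability borel_full_shift R,
  invariant_probability (eta22 @^-1` subshift_of eta_xi) mu /\
  fine (mu [set z : full_shift | z 0]) <= 4^-1.
Proof.
have [mu muE] := image_probability P limit_point_measurable.
exists mu; split; last first.
  rewrite muE -lee_fin fineK; last first.
    by apply: fin_num_measure; exact: limit_coord_measurable.
  (* The stage 0 is the constant sequence 0, so a symbol 1 needs a change. *)
  apply: le_trans (late_change_le 0 0).
  apply: le_measure; rewrite ?inE.
  - exact: limit_coord_measurable.
  - exact: late_change_measurable.
  move=> t /= t0; apply: contrapT => /limit_point_stage e.
  by move: t0; rewrite e.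
split.
  pose XL L : set full_shift := [set z | exists j c,
    forall v : int, v \in window L -> z v = xi (j + v) (+) c].
  have dX L : depends_on (window L) (XL L).
    move=> z w zw [j [c zj]]; exists j, c => v vL.
    by rewrite -zw // zj.
  have XE : eta22 @^-1` subshift_of eta_xi = \bigcap_L XL L.
    apply/seteqP; split=> z /=.
      move=> /preimage_eta_xiP zP L _; have [j [c H]] := zP L.
      by exists j, c => v; rewrite mem_window; exact: H.
    move=> zX; apply/preimage_eta_xiP => L; have [j [c H]] := zX L I.
    by exists j, c => v vL; apply: H; rewrite mem_window.
  have null L : mu (~` XL L) = 0%E.
    apply/eqP; rewrite eq_le measure_ge0 andbT muE; apply/lee_addgt0Pr => e e0.
    have [n Ln ne] := small_enough L (size (window L)) e0.
    rewrite add0e; apply: le_trans (limit_law_le n (depends_onC (dX L))) _.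
    rewrite (_ : stage n @^-1` _ = set0) ?measure0 ?add0e ?lee_fin //.
    rewrite -subset0 => t /=; apply.
    have Lscale : (2 * L < scale n)%N.
      by rewrite scale_reach; have := leq_reach n; lia.
    have [i iP] := xi_part_window (J n t)%:Z Lscale.
    exists i, false => v; rewrite mem_window => vL.
    by rewrite addbF -iP // /stage /shift_iter addrC.
  have mX := subshift_measurable
    (subshift_eta22_preimage (subshift_subshift_of eta_xi)).
  have nullX : mu (~` (eta22 @^-1` subshift_of eta_xi)) = 0%E.
    apply/eqP; rewrite eq_le measure_ge0 andbT.
    have sub : ~` (eta22 @^-1` subshift_of eta_xi) `<=` \bigcup_L (~` XL L).
      by rewrite XE setC_bigcap.
    have mXC L : measurable (~` XL L : set borel_full_shift).
      exact: depends_measurable (depends_onC (dX L)).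
    apply: le_trans (measure_sigma_subadditive mu mXC (measurableC mX) sub) _.
    by rewrite eseries0 ?lexx // => L _ _; exact: null.
  have := probability_setC mu (measurableC mX).
  by rewrite setCK nullX sube0.
move=> A mA.
have [nu nuE] := image_probability mu measurable_shift.
rewrite -[LHS]nuE; apply: probability_eq_local mA => s B Bs.
rewrite nuE !muE; apply: le_anti; rewrite (limit_law_shift_le Bs) /=.
have := limit_law_shift_le (depends_onC Bs).
have mB := preimage_depends_measurable limit_coord_measurable Bs.
have mB' := preimage_depends_measurable limit_coord_measurable
  (depends_on_shift Bs).
have -> : P (limit_point @^-1` (~` B)) = (1 - P (limit_point @^-1` B))%E.
  exact: (probability_setC P mB).
have -> : P (limit_point @^-1` (shift @^-1` (~` B))) =
    (1 - P (limit_point @^-1` (shift @^-1` B)))%E.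
  exact: (probability_setC P mB').
set x := P _; set y' := P _.
have fx : x \is a fin_num by exact: fin_num_measure.
have fy : y' \is a fin_num by exact: fin_num_measure.
by rewrite -(fineK fx) -(fineK fy) -!EFinB !lee_fin; lra.
Qed.
End Limit.

(** * Residues from Lebesgue measure *)

Section UnitInterval.
Context (R : realType).

Let mI : measurable (`[0, 1[%classic : set (measurableTypeR R)) :=
  measurable_itv _.

Definition unit_measure : set (measurableTypeR R) -> \bar R :=
  mrestr lebesgue_measure mI.

HB.instance Definition _ := Measure.on unit_measure.

Let unit_measureT : unit_measure setT = 1%E.
Proof.
rewrite /unit_measure /mrestr setTI lebesgue_measure_itv /=.
by rewrite lte_fin ltr01 sube0.
Qed.

HB.instance Definition _ :=
  Measure_isProbability.Build _ _ _ unit_measure unit_measureT.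

(** The expansion of t in [0, 1[ in the mixed radix base 0, base 1, ... read as
an integer with the first digit as units digit: reversing the digits turns the
nested expansion of t into a compatible sequence of residues. *)
Fixpoint residue (n : nat) (t : R) : nat :=
  if n is n'.+1 then
    (residue n' t +
       scale n' * (Num.truncn (t * (scale n'.+1)%:R)%R %% base n'))%N
  else 0%N.

Lemma residue_lt n t : (residue n t < scale n)%N.
Proof.
elim: n => //= n IH; set r := (_ %% _)%N.
have : (r < base n)%N by rewrite ltn_pmod.
by move: IH; nia.
Qed.

Lemma truncn_scale n (t : R) : 0 <= t ->
  Num.truncn (t * (scale n)%:R) =
  (Num.truncn (t * (scale n.+1)%:R) %/ base n)%N.
Proof.
move=> t0; set k := Num.truncn (_ * (scale n.+1)%:R).
have b0 : 0 < (base n)%:R :> R by rewrite ltr0n.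
have /andP[k1 k2] : k%:R <= t * (scale n.+1)%:R < k.+1%:R.
  by apply: truncn_itv; rewrite mulr_ge0.
rewrite /= natrM mulrA in k1 k2.
apply/eqP; rewrite truncn_eq ?mulr_ge0 //; apply/andP; split.
  rewrite -(ler_pM2r b0); apply: le_trans k1; rewrite -natrM ler_nat.
  exact: leq_divM.
rewrite -(ltr_pM2r b0); apply: (lt_le_trans k2); rewrite -natrM ler_nat.
by rewrite -ltn_divLR.
Qed.

(** On [0, 1[ the residue n t is a function of the integer part of
t * scale n, namely the bijection reversing n digits. *)
Lemma residue_truncn n j : (j < scale n)%N -> exists2 a, (a < scale n)%N &
  forall t : R, 0 <= t < 1 ->
    residue n t = j <-> Num.truncn (t * (scale n)%:R) = a.
Proof.
elim: n j => [|n IH] j jn.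
  exists 0%N => // t /andP[t0 t1]; rewrite /= mulr1; split=> _.
    by apply/eqP; rewrite truncn_eq // t0.
  by move: jn; case: j.
have [a an aP] := IH _ (ltn_pmod j (scale_gt0 n)).
have db : (j %/ scale n < base n)%N by rewrite ltn_divLR ?scale_gt0 // mulnC.
exists (a * base n + j %/ scale n)%N => [|t t01].
  by move: an db => /=; nia.
have := aP t t01; rewrite truncn_scale; last by case/andP: t01.
rewrite [residue n.+1 t]/=.
set k := Num.truncn _; have := residue_lt n t; move: (residue n t) => r rn aP'.
split.
  move=> rj; have rE : r = (j %% scale n)%N.
    by rewrite -rj -modnDmr modnMr addn0 modn_small.
  have kE : (k %% base n = j %/ scale n)%N.
    by rewrite -rj addnC mulnC divnMDl ?scale_gt0 // divn_small // addn0.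
  by rewrite {1}(divn_eq k (base n)) (aP'.1 rE) kE.
move=> kE; have kq : (k %/ base n = a)%N.
  by rewrite kE divnMDl // divn_small // addn0.
have kr : (k %% base n = j %/ scale n)%N by rewrite kE modnMDl modn_small.
by rewrite (aP'.2 kq) kr addnC mulnC -divn_eq.
Qed.

(** The value outside [0, 1[ is arbitrary, as this set is null. *)
Definition unit_residue n (t : measurableTypeR R) : nat :=
  if (0 <= t < 1)%R then residue n t else 0%N.

(** The points of [0, 1[ with a given residue fill an interval of length
1 / scale n. *)
Lemma unit_residueE n j : (j < scale n)%N -> exists2 a, (a < scale n)%N &
  [set t | unit_residue n t = j] `&` `[0, 1[%classic =
  [set` `[a%:R / (scale n)%:R, a.+1%:R / (scale n)%:R[%R].
Proof.
move=> /residue_truncn[a an aP]; exists a => //.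
have p0 : 0 < (scale n)%:R :> R by rewrite ltr0n scale_gt0.
apply/seteqP; split=> t /=; rewrite !in_itv /= /unit_residue.
  move=> [+ t01]; rewrite t01 => /(aP t t01)/eqP.
  rewrite truncn_eq; last by rewrite mulr_ge0 //; case/andP: t01.
  by rewrite ler_pdivrMr // ltr_pdivlMr.
rewrite ler_pdivrMr // ltr_pdivlMr // => ta.
have t01 : 0 <= t < 1.
  case/andP: ta => ta1 ta2; apply/andP; split.
    by rewrite -(pmulr_lge0 _ p0); apply: le_trans ta1.
  rewrite -(ltr_pM2r p0) mul1r; apply: lt_le_trans ta2 _.
  by rewrite ler_nat.
split=> //; rewrite t01; apply/(aP t t01)/eqP.
by rewrite truncn_eq // mulr_ge0 //; case/andP: t01.
Qed.

Lemma unit_residue_uniform : uniform_residues unit_measure unit_residue.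
Proof.
have lt_scale n t : (unit_residue n t < scale n)%N.
  rewrite /unit_residue.
  by case: ifP => _; [exact: residue_lt|exact: scale_gt0].
split=> // [n j|n j jn|n t].
- have [jn|nj] := ltnP j (scale n); last first.
    rewrite (_ : [set t | _] = set0) // -subset0 => t /= tj.
    by have := lt_scale n t; rewrite tj ltnNge nj.
  rewrite -(setUIDK [set t | unit_residue n t = j] `[0, 1[%classic).
  apply: measurableU.
    by have [a _ ->] := unit_residueE jn; exact: measurable_itv.
  have [j0|/eqP j0] := eqVneq j 0%N.
    rewrite (_ : _ `\` _ = ~` `[0, 1[%classic); first exact: measurableC.
    apply/seteqP; split=> t /=; first by case.
    by rewrite in_itv /= => /negP/negbTE t01; rewrite /unit_residue t01 j0.
  rewrite (_ : _ `\` _ = set0) // -subset0 => t [] /=.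
  by rewrite in_itv /= /unit_residue; case: ifP => // _ /esym.
- rewrite /= /unit_measure /mrestr; have [a _ ->] := unit_residueE jn.
  have p0 : 0 < (scale n)%:R :> R by rewrite ltr0n scale_gt0.
  rewrite lebesgue_measure_itv /= lte_fin ltr_pM2r ?invr_gt0 // ltr_nat ltnSn.
  by rewrite -EFinB -mulrBl -natrB // subSnn mul1r.
rewrite /unit_residue; case: ifP => _ //=.
by rewrite addnC mulnC modnMDl.
Qed.

End UnitInterval.

(** * Two invariant measures upstairs *)

Lemma eta22_complement z : eta22 (complement z) = eta22 z.
Proof. by apply/funext => m; rewrite /eta22 /complement addNb addbN negbK. Qed.

Lemma invariant_image (R : realType) (X Y : set full_shift)
    (f : full_shift -> full_shift) (nu : probability borel_full_shift R) :
  invariant_probability X nu ->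
  measurable_fun setT (f : borel_full_shift -> borel_full_shift) ->
  (forall z, f (shift z) = shift (f z)) -> X `<=` f @^-1` Y ->
  subshift X -> subshift Y ->
  exists2 nu' : probability borel_full_shift R, invariant_probability Y nu' &
    forall A, nu' A = nu (f @^-1` A).
Proof.
move=> [nuX nuS] mf fS XY sX sY.
have [nu' nu'E] := image_probability nu mf.
have mY := subshift_measurable sY.
have pre (A : set borel_full_shift) : measurable A ->
    measurable (f @^-1` A : set borel_full_shift).
  by move=> mA; rewrite -[X in measurable X]setTI; exact: mf.
exists nu' => //; split.
  apply: le_anti; rewrite (probability_le1 nu' mY) /= -nuX [leRHS](nu'E Y).
  apply: (le_measure nu _ _ XY); rewrite ?inE; first exact: subshift_measurable.
  exact: pre.
move=> A mA; rewrite !nu'E -[RHS]nuS.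
  by congr (nu _); apply/seteqP; split=> z /=; rewrite fS.
exact: pre.
Qed.

Theorem theorem6p13 (R : realType) :
  exists Y : set full_shift,
    [/\ toeplitz_subshift Y,
        strictly_ergodic R Y,
        minimal (eta22 @^-1` Y)
      & ~ uniquely_ergodic R (eta22 @^-1` Y)].
Proof.
have [mu [muI mu4]] := limit_measure (unit_residue_uniform R).
have sY := subshift_subshift_of eta_xi.
have sX := subshift_eta22_preimage sY.
exists (subshift_of eta_xi); split.
- by exists eta_xi => //; exact: toeplitz_eta_xi.
- split; first exact: minimal_eta_xi.
  have [nu nuI _] := invariant_image muI measurable_eta22 eta22_shift
    (fun _ => id) sX sY.
  exists nu => // nu' nu'I; exact: unique_invariant_eta_xi.
- exact: minimal_preimage_eta_xi.
case=> mu0 mu0I uniq.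
have [mu' mu'I mu'E] : exists2 mu' : probability borel_full_shift R,
    invariant_probability (eta22 @^-1` subshift_of eta_xi) mu' &
    forall A, mu' A = mu (complement @^-1` A).
  apply: (invariant_image muI measurable_complement) => // z /=.
  by rewrite eta22_complement.
have m0 := coord_measurable 0.
have : mu' [set z : full_shift | z 0] = mu [set z : full_shift | z 0].
  by rewrite !uniq.
rewrite mu'E (_ : complement @^-1` _ = ~` [set z : full_shift | z 0]).
  rewrite (probability_setC mu m0) => /(congr1 fine).
  by rewrite fineB ?fin_num_measure //=; move: mu4; lra.
by apply/seteqP; split=> z /=; rewrite /complement => /negP.
Qed.
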